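(* For every fixed integer $n\ge 1$, we have $\lim_{m\to\infty} d_{\mathrm{GH}}(B^m,B^n)=1$.
   Context: $B^n=\{x\in\mathbb{R}^n : x_1^2+\cdots+x_n^2\le 1\}$ is the closed unit ball, regarded as a metric space with the Euclidean metric. The Gromov--Hausdorff distance $d_{\mathrm{GH}}(X,Y)$ between metric spaces $X,Y$ is the infimum, over all metric spaces $Z$ and isometric embeddings $\phi\colon X\to Z$, $\psi\colon Y\to Z$, of the Hausdorff distance in $Z$ between $\phi(X)$ and $\psi(Y)$. Equivalently, $d_{\mathrm{GH}}(X,Y)=\frac12\inf_C \sup_{(x,y),(x',y')\in C}|d_X(x,x')-d_Y(y,y')|$, where $C$ ranges over all correspondences, i.e. relations $C\subseteq X\times Y$ whose projections to $X$ and to $Y$ are both surjective. *)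

(* Defs.v *)
From HB Require Import structures.
From mathcomp Require Import all_boot all_order all_algebra.
From mathcomp Require Import all_classical all_reals all_analysis.
From mathcomp Require Import ring.

Set Implicit Arguments.
Unset Strict Implicit.
Unset Printing Implicit Defensive.

Import Order.TTheory GRing.Theory Num.Theory.
Import numFieldNormedType.Exports.

Local Open Scope classical_set_scope.
Local Open Scope ring_scope.

Section SubsetMetric.
Context {R : realType} {X : metricType R} (A : set X).

Let dist (x y : set_type A) : R := mdist (set_val x) (set_val y).

Let dist_ge0 x y : 0 <= dist x y.
Proof. exact: mdist_ge0. Qed.

Let dist_positivity x y : dist x y = 0 -> x = y.
Proof. by move=> /mdist_positivity; exact: val_inj. Qed.

Let ball_dist x e : ball x e = [set y | dist x y < e].
Proof.
apply/funext => y; rewrite -[LHS]/(ball (set_val x) e (set_val y)).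
by rewrite ballEmdist.
Qed.

(* The balls of a subset are those of the library's subset topology. *)
HB.instance Definition _ := @PseudoMetric_isMetric.Build R (set_type A)
  dist dist_ge0 dist_positivity ball_dist.

End SubsetMetric.

(* An alias of 'rV[R]_n, whose own library metric is that of the sup norm. *)
Definition euclidean_space (R : realType) (n : nat) : Type := 'rV[R]_n.

Section EuclideanMetric.
Context {R : realType} {n : nat}.
Local Notation E := (euclidean_space R n).
Implicit Types x y z : 'rV[R]_n.

HB.instance Definition _ := Choice.copy E 'rV[R]_n.

Definition euclidean_dist (x y : E) : R :=
  Num.sqrt (\sum_(i < n) ((x : 'rV[R]_n) 0 i - (y : 'rV[R]_n) 0 i) ^+ 2).

Lemma sum_sqr_ge0 (a : 'I_n -> R) : 0 <= \sum_i a i ^+ 2.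
Proof. by apply: sumr_ge0 => i _; exact: sqr_ge0. Qed.

Lemma cauchy_schwarz_sum (a b : 'I_n -> R) :
  (\sum_i a i * b i) ^+ 2 <= (\sum_i a i ^+ 2) * (\sum_i b i ^+ 2).
Proof.
set C := \sum_i a i * b i; set A := \sum_i a i ^+ 2; set B := \sum_i b i ^+ 2.
have B_ge0 : 0 <= B by exact: sum_sqr_ge0.
have sum_ge0 : 0 <= B * (A * B - C ^+ 2).
  suff -> : B * (A * B - C ^+ 2) = \sum_i (B * a i - C * b i) ^+ 2.
    exact: sum_sqr_ge0.
  under eq_bigr => i _.
    rewrite (_ : _ ^+ 2 =
      B ^+ 2 * a i ^+ 2 - 2 * B * C * (a i * b i) + C ^+ 2 * b i ^+ 2); last first.
      by ring.
    over.
  by rewrite !big_split/= sumrN -!mulr_sumr -/A -/B -/C; ring.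
have [B_gt0|] := ltrP 0 B; first by rewrite -subr_ge0 -(pmulr_rge0 _ B_gt0).
move=> B_le0; have /eqP B0 : B == 0 by rewrite eq_le B_le0.
have b0 i : b i = 0.
  apply/eqP; rewrite -sqrf_eq0; move/eqP: B0.
  rewrite psumr_eq0 => [/allP/(_ i)|j _]; last exact: sqr_ge0.
  by rewrite mem_index_enum => /(_ isT).
rewrite /C big1 ?expr0n/= ?B0 ?mulr0// => i _.
by rewrite b0 mulr0.
Qed.

Lemma minkowski_sum (a b : 'I_n -> R) :
  Num.sqrt (\sum_i (a i + b i) ^+ 2) <=
  Num.sqrt (\sum_i a i ^+ 2) + Num.sqrt (\sum_i b i ^+ 2).
Proof.
rewrite -(@ler_pXn2r _ 2)// ?nnegrE ?addr_ge0 ?sqrtr_ge0//.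
rewrite sqrrD !sqr_sqrtr ?sum_sqr_ge0//.
under eq_bigr do rewrite sqrrD.
rewrite 2!big_split/= lerD2r lerD2l sumrMnl lerMn2r/=.
rewrite -sqrtrM ?sum_sqr_ge0// (le_trans (ler_norm _))//.
by rewrite -sqrtr_sqr ler_wsqrtr// cauchy_schwarz_sum.
Qed.

Let dxx (x : E) : euclidean_dist x x = 0.
Proof.
by rewrite /euclidean_dist big1 ?sqrtr0// => i _; rewrite subrr expr0n.
Qed.

Let d_positivity (x y : E) : euclidean_dist x y = 0 -> x = y.
Proof.
move=> /eqP; rewrite sqrtr_eq0 => le0.
have /eqP : \sum_(i < n) ((x : 'rV[R]_n) 0 i - (y : 'rV[R]_n) 0 i) ^+ 2 = 0.
  by apply/eqP; rewrite eq_le le0 sum_sqr_ge0.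
rewrite psumr_eq0 => [/allP eq0|i _]; last exact: sqr_ge0.
apply/rowP => i; apply/eqP; rewrite -subr_eq0 -sqrf_eq0.
by have := eq0 i; rewrite mem_index_enum => /(_ isT).
Qed.

Let d_sym (x y : E) : euclidean_dist x y = euclidean_dist y x.
Proof.
by congr Num.sqrt; apply: eq_bigr => i _; rewrite -sqrrN opprB.
Qed.

Let d_triangle (y x z : E) :
  euclidean_dist x z <= euclidean_dist x y + euclidean_dist y z.
Proof.
apply: le_trans (minkowski_sum _ _); rewrite le_eqVlt; apply/orP; left.
by apply/eqP; congr Num.sqrt; apply: eq_bigr => i _; rewrite addrA subrK.
Qed.

HB.instance Definition _ := @isMetric.Build R E
  euclidean_dist dxx d_positivity d_sym d_triangle.

End EuclideanMetric.

Definition unit_ball (R : realType) (n : nat) : set (euclidean_space R n) :=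
  [set x : 'rV[R]_n | \sum_(i < n) x 0 i ^+ 2 <= 1].

Arguments unit_ball R n : clear implicits.

(* Equal to max (sup_(a in A) d(a, B), sup_(b in B) d(b, A)) when A and B are
   nonempty; ball is the library's open ball, as a subset of Z. *)
Definition hausdorff_distance (R : realType) (Z : metricType R)
    (A B : set Z) : \bar R :=
  ereal_inf (EFin @` [set r : R | [/\ 0 < r,
    A `<=` \bigcup_(b in B) ball b r & B `<=` \bigcup_(a in A) ball a r]]).

Definition isometric_embedding (R : realType) (X Z : metricType R)
    (f : X -> Z) : Prop :=
  forall x x' : X, mdist (f x) (f x') = mdist x x'.

Definition gromov_hausdorff_distance (R : realType)
    (X Y : metricType R) : \bar R :=
  ereal_inf [set e : \bar R |
    exists (Z : metricType R) (phi : X -> Z) (psi : Y -> Z),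
      [/\ isometric_embedding phi, isometric_embedding psi &
          e = hausdorff_distance (range phi) (range psi)]].

(* Main.v *)
Require Import Defs.
From mathcomp Require Import all_boot all_order all_algebra.
From mathcomp Require Import all_classical all_reals all_analysis.
From mathcomp Require Import ring lra.
Set Implicit Arguments.
Unset Strict Implicit.
Unset Printing Implicit Defensive.
Import Order.TTheory GRing.Theory Num.Theory.
Import numFieldNormedType.Exports.
Local Open Scope classical_set_scope.
Local Open Scope ring_scope.

(** Let e > 0 and suppose that the balls of dimensions m and n lie isometrically
in a metric space at Hausdorff distance less than 1 - e.  Sending each point of
B^m to a point of B^n within 1 - e of it changes distances by less than 2 - 2e.
Cut B^n into N cells of diameter at most e, where N depends only on n and e
([grid_cell_dist]).  Points of B^m sent to the same cell are then at distance at
most 2 - e, so the N cells colour the sphere with no two nearly antipodal points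
of the same colour.  For large m this is impossible.  Instead of the
Borsuk-Ulam theorem, the proof uses concentration of measure on the cube of
vertices (+-1, ..., +-1) / sqrt m, inscribed in the sphere: there, a set with no
nearly antipodal pair has density O(1/m) ([card_small_diameter]), which follows
from the Poincare inequality ([cube_poincare]); hence N is at least of order m
([cube_colouring], [colours_bound_dimension]).

Conversely, the distance never exceeds 1: when B^m and B^n are placed in
orthogonal subspaces of R^(m+n), every point of either ball is within 1 of the
origin, which belongs to both ([gromov_hausdorff_unit_balls_le1]). *)

(** * Concentration of measure on the discrete cube *)

Definition hamming (m : nat) (s t : m.-tuple bool) : nat :=
  (\sum_(i < m) (tnth s i != tnth t i))%N.

Definition antipode (m : nat) (s : m.-tuple bool) : m.-tuple bool :=
  map_tuple negb s.

Lemma antipodeK m : involutive (@antipode m).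
Proof. by move=> s; apply: eq_from_tnth => i; rewrite !tnth_map negbK. Qed.

Lemma hamming_sym m (s t : m.-tuple bool) : hamming s t = hamming t s.
Proof. by apply: eq_bigr => i _; rewrite eq_sym. Qed.

Lemma hammingxx m (s : m.-tuple bool) : hamming s s = 0%N.
Proof. by apply: big1 => i _; rewrite eqxx. Qed.

Lemma hamming_triangle m (t s u : m.-tuple bool) :
  (hamming s u <= hamming s t + hamming t u)%N.
Proof.
rewrite -big_split; apply: leq_sum => i _.
by case: (tnth s i) (tnth t i) (tnth u i) => [] [] [].
Qed.

Lemma hamming_cons m (a b : bool) (s t : m.-tuple bool) :
  hamming [tuple of a :: s] [tuple of b :: t] = ((a != b) + hamming s t)%N.
Proof.
rewrite /hamming big_ord_recl !tnth0; congr addn.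
by apply: eq_bigr => i _; rewrite !tnthS.
Qed.

Lemma hamming_antipode m (s t : m.-tuple bool) :
  hamming (antipode s) (antipode t) = hamming s t.
Proof.
by apply: eq_bigr => i _; rewrite !tnth_map (inj_eq negb_inj).
Qed.

Lemma hamming_antipodel m (s t : m.-tuple bool) :
  (hamming (antipode s) t + hamming s t)%N = m.
Proof.
rewrite -big_split -[RHS]card_ord -sum1_card; apply: eq_bigr => i _.
by rewrite tnth_map; case: (tnth s i) (tnth t i) => [] [].
Qed.

Lemma sum_tuple_cons (R : realType) m (f : m.+1.-tuple bool -> R) :
  \sum_t f t = \sum_(t : m.-tuple bool) f [tuple of true :: t] +
                \sum_(t : m.-tuple bool) f [tuple of false :: t].
Proof.
rewrite (reindex (fun p : bool * m.-tuple bool => [tuple of p.1 :: p.2])).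
  by rewrite -(pair_bigA _ (fun (b : bool) (t : m.-tuple bool) => f [tuple of b :: t])) big_bool.
exists (fun t : m.+1.-tuple bool => (thead t, [tuple of behead t])) => [[b t] _|t _] /=.
  by congr pair; apply: val_inj.
by rewrite -tuple_eta.
Qed.

(** Since 4 ^ m is the square of the number of vertices, this bounds the variance
of an L-Lipschitz function by L ^ 2 * m / 4.  When the cube is split along its
first coordinate, the variance is the mean of the variances on the two halves
plus a quarter of the squared difference of the two means, and that difference
is at most L. *)
Lemma cube_poincare (R : realType) (L : R) m (f : m.-tuple bool -> R) :
  (forall s t, `|f s - f t| <= L * (hamming s t)%:R) ->
  2 ^+ m * (\sum_s f s ^+ 2) - (\sum_s f s) ^+ 2 <=
    L ^+ 2 * m%:R / 4 * 4 ^+ m.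
Proof.
elim: m f => [|m IH] f Lf.
  have sum1 (g : 0.-tuple bool -> R) : \sum_s g s = g [tuple].
    rewrite (bigD1 [tuple])//= big1 ?addr0// => s.
    by rewrite (tuple0 s) => /negP[].
  by rewrite !sum1 expr0 mul1r subrr mulr0 !mul0r.
have step b : forall s t : m.-tuple bool,
    `|f [tuple of b :: s] - f [tuple of b :: t]| <= L * (hamming s t)%:R.
  by move=> s t; apply: le_trans (Lf _ _) _; rewrite hamming_cons eqxx.
have := IH _ (step true); have := IH _ (step false).
have : (\sum_(s : m.-tuple bool) f [tuple of true :: s] -
        \sum_(s : m.-tuple bool) f [tuple of false :: s]) ^+ 2 <= L ^+ 2 * 4 ^+ m.
  have -> : (4 : R) ^+ m = (2 ^+ m) ^+ 2 by rewrite expr2 -exprMn -natrM.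
  rewrite -exprMn -ler_sqrt ?sqr_ge0// !sqrtr_sqr -sumrB.
  apply: le_trans (ler_norm_sum _ _ _) _.
  apply: le_trans (ler_norm _); rewrite mulrC.
  have -> : (2 : R) ^+ m * L = \sum_(s : m.-tuple bool) L.
    by rewrite sumr_const card_tuple card_bool -[RHS]mulr_natl natrX.
  apply: ler_sum => s _; apply: le_trans (Lf _ _) _.
  by rewrite hamming_cons hammingxx mulr1.
rewrite !sum_tuple_cons !exprS -[m.+1%:R]natr1.
set P := 2 ^+ m; set Q := 4 ^+ m.
set a := \sum_s _; set b := \sum_s _; set c := \sum_s _; set d := \sum_s _.
nra.
Qed.

(** The default value m, the diameter of the cube, keeps the function 1-Lipschitz
when A is empty. *)
Definition set_distance (R : realType) m (A : pred (m.-tuple bool))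
    (s : m.-tuple bool) : R :=
  \big[Order.min/m%:R]_(t | A t) (hamming s t)%:R.

Lemma set_distance_lipschitz (R : realType) m A (s t : m.-tuple bool) :
  set_distance R A s <= (hamming s t)%:R + set_distance R A t.
Proof.
rewrite -lerBlDl; apply: le_bigmin => [|u Au].
  by rewrite lerBlDl (le_trans (bigmin_le_id _ _ _ _))// lerDr.
rewrite lerBlDl; apply: le_trans (bigmin_le_cond _ _ Au) _.
by rewrite -natrD ler_nat hamming_triangle.
Qed.

(** The function g below, the distance to A minus the distance to the antipode of
A, has mean zero by symmetry and is 2-Lipschitz, so the Poincare inequality
bounds the mean of its square by m.  On A its absolute value is at least d * m,
because the antipode of a point of A is that far from A. *)
Lemma card_small_diameter (R : realType) m (A : pred (m.-tuple bool)) (d : R) :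
  0 <= d -> d <= 1 ->
  (forall s t, A s -> A t -> (hamming s t)%:R <= (1 - d) * m%:R) ->
  #|A|%:R * (d ^+ 2 * m%:R) <= 2 ^+ m.
Proof.
move=> d0 d1 diamA.
case: (posnP m) => [m0|m0]; first by have -> : m%:R = 0 :> R by [rewrite m0]; rewrite !mulr0 exprn_ge0.
have mR0 : 0 < m%:R :> R by rewrite ltr0n.
pose g s := set_distance R A s - set_distance R A (antipode s).
have g_lip s t : `|g s - g t| <= 2 * (hamming s t)%:R.
  have := set_distance_lipschitz R A s t.
  have := set_distance_lipschitz R A t s.
  have := set_distance_lipschitz R A (antipode s) (antipode t).
  have := set_distance_lipschitz R A (antipode t) (antipode s).
  rewrite !hamming_antipode (hamming_sym t s) /g ler_norml.
  by move=> *; apply/andP; split; lra.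
have sum_g : \sum_s g s = 0.
  rewrite sumrB [X in _ - X](reindex_inj (inv_inj (@antipodeK m))).
  by apply/eqP; rewrite subr_eq0; apply/eqP/eq_bigr => s _; rewrite antipodeK.
have gA s : A s -> (d * m%:R) ^+ 2 <= g s ^+ 2.
  move=> As.
  have h0 : set_distance R A s <= 0.
    by apply: le_trans (bigmin_le_cond _ _ As) _; rewrite hammingxx.
  have h1 : d * m%:R <= set_distance R A (antipode s).
    apply: le_bigmin => [|t At]; first by rewrite ler_piMl// ltW.
    have := diamA _ _ As At.
    have : (hamming (antipode s) t)%:R + (hamming s t)%:R = m%:R :> R.
      by rewrite -natrD hamming_antipodel.
    lra.
  have : 0 <= d * m%:R by rewrite mulr_ge0.
  rewrite /g; nra.
have : #|A|%:R * (d * m%:R) ^+ 2 <= \sum_s g s ^+ 2.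
  rewrite mulr_natl -sumr_const [leRHS](bigID A)/= -[leLHS]addr0.
  by apply: lerD; [exact: ler_sum | apply: sumr_ge0 => s _; exact: sqr_ge0].
have := cube_poincare g_lip; rewrite sum_g expr0n/= subr0.
have -> : (4 : R) ^+ m = 2 ^+ m * 2 ^+ m by rewrite -exprMn -natrM.
set S := \sum_s _; have P0 : 0 < (2 : R) ^+ m by rewrite exprn_gt0.
move=> H1 H2.
have {}H1 : S <= m%:R * 2 ^+ m.
  rewrite -(ler_pM2l P0); apply: le_trans H1 _.
  by rewrite le_eqVlt; apply/orP; left; apply/eqP; field.
rewrite -(ler_pM2l mR0); apply: le_trans H1; apply: le_trans H2.
by rewrite le_eqVlt; apply/orP; left; apply/eqP; ring.
Qed.

(** Each colour class occupies at most a fraction 1 / (d ^ 2 * m) of the cube. *)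
Lemma cube_colouring (R : realType) m (F : finType) (c : m.-tuple bool -> F)
    (d : R) : 0 <= d -> d <= 1 ->
  (forall s t, c s = c t -> (hamming s t)%:R <= (1 - d) * m%:R) ->
  d ^+ 2 * m%:R <= #|F|%:R.
Proof.
move=> d0 d1 dc.
have P0 : 0 < (2 : R) ^+ m by rewrite exprn_gt0.
rewrite -(ler_pM2l P0).
have card_cube : (2 : R) ^+ m = \sum_(k : F) #|[pred s | c s == k]|%:R.
  rewrite -natr_sum -natrX; congr _%:R.
  rewrite -card_bool -card_tuple -sum1_card (partition_big c predT)//=.
  by apply: eq_bigr => k _; rewrite sum1_card.
rewrite [X in X * _ <= _]card_cube mulr_suml.
apply: le_trans (_ : \sum_(k : F) 2 ^+ m <= _).
  apply: ler_sum => k _; apply: card_small_diameter => // s t.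
  by move=> /eqP sk /eqP tk; apply: dc; rewrite sk tk.
by rewrite sumr_const -[leLHS]mulr_natr.
Qed.

(** * Cubes and grids in Euclidean balls *)

Definition cube_point (R : realType) m (s : m.-tuple bool) : 'rV[R]_m :=
  \row_i ((-1) ^+ tnth s i / Num.sqrt m%:R).

Lemma cube_point_unit_ball (R : realType) m (s : m.-tuple bool) :
  unit_ball R m (cube_point R s).
Proof.
rewrite /unit_ball/=; case: (posnP m) => [m0|m0].
  rewrite big1 ?ler01// => i _; suff : (0 < 0)%N by [].
  by rewrite -{2}m0; exact: leq_ltn_trans (leq0n i) (ltn_ord i).
under eq_bigr => i _.
  rewrite mxE exprMn exprVn sqr_sqrtr ?ler0n// -exprM mulnC exprM sqrrN !expr1n.
  rewrite mul1r; over.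
by rewrite sumr_const card_ord -[leLHS]mulr_natl mulfV// pnatr_eq0 -lt0n.
Qed.

Lemma cube_point_dist (R : realType) m (s t : m.-tuple bool) :
  m%:R * euclidean_dist (cube_point R s : euclidean_space R m)
                       (cube_point R t) ^+ 2 = 4 * (hamming s t)%:R.
Proof.
rewrite sqr_sqrtr ?sum_sqr_ge0// mulr_sumr natr_sum mulr_sumr.
apply: eq_bigr => i _; rewrite !mxE -mulrBl exprMn exprVn sqr_sqrtr ?ler0n//.
have m0 : m%:R != 0 :> R by rewrite pnatr_eq0 -lt0n (leq_ltn_trans _ (ltn_ord i)).
rewrite mulrCA mulfV// mulr1.
by case: (tnth s i) (tnth t i) => [] []; rewrite /= ?expr0 ?expr1; ring.
Qed.

(** The index of the cube of side 1 / K that contains y; it determines the cell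
only for y in [-1, 1] ^ n, where the truncated values do not exceed 2 * K. *)
Definition grid_cell (R : realType) n (K : nat) (y : 'rV[R]_n) :
    {ffun 'I_n -> 'I_(2 * K).+1} :=
  [ffun i => inord (Num.truncn (K%:R * (y 0 i + 1)))].

Lemma grid_cell_dist (R : realType) n K (y z : 'rV[R]_n) :
  unit_ball R n y -> unit_ball R n z -> grid_cell K y = grid_cell K z ->
  K%:R * euclidean_dist (y : euclidean_space R n) z <= n%:R.
Proof.
move=> y1 z1 yz.
have coord (w : 'rV[R]_n) i : unit_ball R n w -> -1 <= w 0 i <= 1.
  rewrite /unit_ball/= => w1; rewrite -ler_norml -(@ler_pXn2r _ 2)// ?nnegrE//.
  rewrite expr1n real_normK ?num_real//; apply: le_trans w1.
  by rewrite (bigD1 i)//= lerDl; apply: sumr_ge0 => j _; exact: sqr_ge0.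
have cell (w : 'rV[R]_n) i : unit_ball R n w ->
    (grid_cell K w i)%:R <= K%:R * (w 0 i + 1) < (grid_cell K w i)%:R + 1.
  move=> /(@coord _ i)/andP[wN1 w1].
  have w0 : 0 <= K%:R * (w 0 i + 1) by rewrite mulr_ge0 ?ler0n//; lra.
  rewrite ffunE inordK; last first.
    rewrite ltnS -(ler_nat R); have /andP[h _] := truncn_itv w0.
    apply: le_trans h _; rewrite natrM mulrC ler_wpM2r ?ler0n//; lra.
  by have := truncn_itv w0; rewrite -natr1.
have close i : (K%:R * (y 0 i - z 0 i)) ^+ 2 <= 1.
  have := cell y i y1; have := cell z i z1; rewrite yz => /andP[a b] /andP[c d].
  rewrite -[leLHS]real_normK ?num_real// -[leRHS](expr1n _ 2).
  rewrite ler_pXn2r ?nnegrE//.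
  by rewrite ler_norml; apply/andP; split; lra.
rewrite -(@ler_pXn2r _ 2)// ?nnegrE ?mulr_ge0 ?ler0n ?sqrtr_ge0//.
rewrite exprMn sqr_sqrtr ?sum_sqr_ge0// mulr_sumr.
apply: le_trans (_ : \sum_(i < n) 1 <= _).
  by apply: ler_sum => i _; rewrite -exprMn.
rewrite sumr_const card_ord -natrX ler_nat.
by case: (n) => // k; rewrite leq_pmulr.
Qed.

(** * Bounds on the Gromov-Hausdorff distance *)

Lemma gromov_hausdorff_unit_balls_le1 (R : realType) m n :
  (gromov_hausdorff_distance (set_type (unit_ball R m))
                             (set_type (unit_ball R n)) <= 1%:E)%E.
Proof.
pose phi (x : set_type (unit_ball R m)) : euclidean_space R (m + n) :=
  row_mx (set_val x : 'rV[R]_m) (0 : 'rV[R]_n).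
pose psi (y : set_type (unit_ball R n)) : euclidean_space R (m + n) :=
  row_mx (0 : 'rV[R]_m) (set_val y : 'rV[R]_n).
have phi_isom : isometric_embedding phi.
  move=> x x'; congr Num.sqrt; rewrite big_split_ord/= [X in _ + X]big1 ?addr0; last first.
    by move=> i _; rewrite !row_mxEr subrr expr0n.
  by apply: eq_bigr => i _; rewrite !row_mxEl.
have psi_isom : isometric_embedding psi.
  move=> x x'; congr Num.sqrt; rewrite big_split_ord/= big1 ?add0r; last first.
    by move=> i _; rewrite !row_mxEl subrr expr0n.
  by apply: eq_bigr => i _; rewrite !row_mxEr.
have ball0 k : unit_ball R k (0 : 'rV[R]_k).
  by rewrite /unit_ball/= big1 ?ler01// => i _; rewrite mxE expr0n.
pose o k : set_type (unit_ball R k) := SigSub (mem_set (ball0 k)).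
have phi_near x : mdist (psi (o n)) (phi x) <= 1.
  rewrite -[leRHS]sqrtr1; apply: ler_wsqrtr.
  rewrite big_split_ord/= [X in _ + X]big1 ?addr0; last first.
    by move=> i _; rewrite !row_mxEr subrr expr0n.
  apply: le_trans (set_valP x); rewrite le_eqVlt; apply/orP; left; apply/eqP.
  by apply: eq_bigr => i _; rewrite !row_mxEl mxE sub0r sqrrN.
have psi_near y : mdist (phi (o m)) (psi y) <= 1.
  rewrite -[leRHS]sqrtr1; apply: ler_wsqrtr.
  rewrite big_split_ord/= big1 ?add0r; last first.
    by move=> i _; rewrite !row_mxEl subrr expr0n.
  apply: le_trans (set_valP y); rewrite le_eqVlt; apply/orP; left; apply/eqP.
  by apply: eq_bigr => i _; rewrite !row_mxEr mxE sub0r sqrrN.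
apply: ge_ereal_inf; exists (hausdorff_distance (range phi) (range psi)).
  by exists (euclidean_space R (m + n)), phi, psi.
apply/lee_addgt0Pr => e e0; apply: ge_ereal_inf; exists (1 + e)%:E => //.
exists (1 + e) => //; split; first lra.
- move=> _ [x _ <-]; exists (psi (o n)); first by exists (o n).
  by rewrite ballEmdist/=; have := phi_near x; lra.
- move=> _ [y _ <-]; exists (phi (o m)); first by exists (o m).
  by rewrite ballEmdist/=; have := psi_near y; lra.
Qed.

(** Vertices s, t of the cube whose images fall in the same cell satisfy
dist s t <= 2 r + e <= 2 - e.  As the squared distance is 4 / m times the Hamming
distance and (2 - e) ^ 2 <= 4 - 2 e, their Hamming distance is at most
(1 - e / 2) * m. *)
Lemma colours_bound_dimension (R : realType) (m n K : nat) (e : R) (Z : metricType R)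
    (phi : set_type (unit_ball R m) -> Z) (psi : set_type (unit_ball R n) -> Z)
    (r : R) :
  0 <= e -> e <= 1 -> (0 < K)%N -> n%:R <= K%:R * e ->
  isometric_embedding phi -> isometric_embedding psi ->
  range phi `<=` \bigcup_(b in range psi) ball b r -> r <= 1 - e ->
  (e / 2) ^+ 2 * m%:R <= #|{ffun 'I_n -> 'I_(2 * K).+1}|%:R.
Proof.
move=> e0 e1 K0 nK phi_isom psi_isom cover re.
have [f fP] : {f : set_type (unit_ball R m) -> set_type (unit_ball R n) &
    forall x, mdist (psi (f x)) (phi x) < r}.
  apply: (@choice _ _ (fun x y => mdist (psi y) (phi x) < r)) => x.
  have [|_ [y _ <-]] := cover (phi x); first by exists x.
  by rewrite ballEmdist; exists y.
pose p (s : m.-tuple bool) : set_type (unit_ball R m) :=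
  SigSub (mem_set (cube_point_unit_ball R s)).
apply: (cube_colouring (c := fun s => grid_cell K (set_val (f (p s))))).
- lra.
- lra.
move=> s t /(grid_cell_dist (set_valP _) (set_valP _)).
rewrite -[X in _ * X]/(mdist (f (p s)) (f (p t))) => st.
set D := mdist (f (p s)) (f (p t)) in st.
have D0 : 0 <= D := mdist_ge0 _ _.
have De : D <= e.
  by rewrite -(@ler_pM2l _ K%:R) ?ltr0n//; exact: le_trans st nK.
have pst : mdist (p s) (p t) <= 2 - e.
  rewrite -phi_isom.
  have := metric_triangle (phi (p s)) (psi (f (p s))) (phi (p t)).
  have := metric_triangle (psi (f (p s))) (psi (f (p t))) (phi (p t)).
  rewrite psi_isom -/D.
  have := fP (p s); have := fP (p t).
  rewrite (metric_sym (psi (f (p s))) (phi (p s))).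
  lra.
have p0 : 0 <= mdist (p s) (p t) := mdist_ge0 _ _.
have sqr_pst : mdist (p s) (p t) ^+ 2 <= 4 - 2 * e by nra.
have := ler_wpM2l (ler0n R m) sqr_pst.
rewrite [X in X <= _](cube_point_dist R s t).
lra.
Qed.

Lemma gromov_hausdorff_unit_balls_ge (R : realType) (n : nat) (e : R) :
  0 < e -> e <= 1 ->
  \forall m \near \oo, ((1 - e)%:E <=
    gromov_hausdorff_distance (set_type (unit_ball R m))
                              (set_type (unit_ball R n)))%E.
Proof.
move=> e0 e1.
pose K := (Num.truncn (n%:R / e)).+1.
have nK : n%:R <= K%:R * e.
  by rewrite -ler_pdivrMr// ltW// truncnS_gt.
pose N : R := #|{ffun 'I_n -> 'I_(2 * K).+1}|%:R.
near=> m.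
have mN : N < (e / 2) ^+ 2 * m%:R.
  rewrite mulrC -ltr_pdivrMr ?exprn_gt0 ?divr_gt0//.
  near: m; exact: nbhs_infty_gtr.
apply: le_ereal_inf_tmp => _ [Z [phi [psi [phi_isom psi_isom ->]]]].
apply: le_ereal_inf_tmp => _ [r [_ cover _] <-]; rewrite lee_fin leNgt.
apply/negP => /ltW re; move: mN; rewrite ltNge => /negP; apply.
exact: colours_bound_dimension (ltW e0) e1 _ nK phi_isom psi_isom cover re.
Unshelve. all: by end_near. Qed.

Theorem mainTheorem4 (R : realType) (n : nat) (hn : (1 <= n)%N) :
  (fun m : nat =>
     gromov_hausdorff_distance (set_type (unit_ball R m))
                               (set_type (unit_ball R n)))
    @ \oo --> (1%:E : \bar R).
Proof.
apply/fine_cvgP; split.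
  (* The lower bound 1 - 1 = 0 suffices for finiteness. *)
  near=> m; have ge0 : ((1 - 1)%:E <= gromov_hausdorff_distance
      (set_type (unit_ball R m)) (set_type (unit_ball R n)))%E.
    by near: m; exact: gromov_hausdorff_unit_balls_ge.
  rewrite fin_numE; apply/andP; split; apply/eqP => d_inf.
    by move: ge0; rewrite d_inf.
  by have := gromov_hausdorff_unit_balls_le1 R m n; rewrite d_inf.
apply/cvgrPdist_le => e e0.
(* The lower bound is available only for errors at most 1. *)
have e'0 : 0 < Num.min e 1 by rewrite lt_min e0 ltr01.
have e'1 : Num.min e 1 <= 1 by rewrite ge_min lexx orbT.
have e'e : Num.min e 1 <= e by rewrite ge_min lexx.
near=> m; have ge_e : ((1 - Num.min e 1)%:E <= gromov_hausdorff_distance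
    (set_type (unit_ball R m)) (set_type (unit_ball R n)))%E.
  by near: m; exact: gromov_hausdorff_unit_balls_ge.
have := gromov_hausdorff_unit_balls_le1 R m n; move: ge_e => /=.
case: gromov_hausdorff_distance => [x| |]//=; rewrite !lee_fin => ge_e le1.
by rewrite ger0_norm; lra.
Unshelve. all: by end_near. Qed.
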